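(* Let $k,\ell\ge 1$ be integers, let $a_1,\dots,a_k$ and $b_{11},\dots,b_{1\ell},\dots,b_{k1},\dots,b_{k\ell}$ be fixed non-zero integers. For $c\in\mathbb Z$ consider the exponential diophantine equation $$a_1 b_{11}^{\alpha_{11}}\cdots b_{1\ell}^{\alpha_{1\ell}}+\dots+a_k b_{k1}^{\alpha_{k1}}\cdots b_{k\ell}^{\alpha_{k\ell}}=c \qquad (E_c)$$ in non-negative integers $\alpha_{ij}$, and for an integer $m\ge 2$ the congruence $$a_1 b_{11}^{\alpha_{11}}\cdots b_{1\ell}^{\alpha_{1\ell}}+\dots+a_k b_{k1}^{\alpha_{k1}}\cdots b_{k\ell}^{\alpha_{k\ell}}\equiv c \pmod m \qquad (E_{c,m})$$ in non-negative integers $\alpha_{ij}$. Let $$H_0=\{c\in\mathbb Z:\ (E_c)\text{ has no solution}\},$$ $$H=\{c\in\mathbb Z:\ (E_c)\text{ has no solution, but } (E_{c,m}) \text{ is solvable for every integer } m\ge 2\}.$$ Then $H$ has density zero inside $H_0$, i.e. $$\lim_{x\to\infty}\frac{\#\{c\in H: |c|\le x\}}{\#\{c\in H_0:|c|\le x\}}=0.$$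
   Context: $\#C$ denotes the number of elements of a finite set $C$. For sets $A\subseteq B\subseteq\mathbb Z$, the density of $A$ inside $B$ is $\lim_{x\to\infty}\#\{a\in A:|a|\le x\}/\#\{b\in B:|b|\le x\}$, when this limit exists. *)

(* Defs.v *)
From HB Require Import structures.
From mathcomp Require Import all_boot all_order all_algebra.
From mathcomp Require Import all_classical all_reals all_analysis.
Set Implicit Arguments. Unset Strict Implicit. Unset Printing Implicit Defensive.
Import Order.TTheory GRing.Theory Num.Theory.
Local Open Scope ring_scope.

Definition expsum (k l : nat) (a : 'I_k -> int) (b : 'I_k -> 'I_l -> int)
  (alpha : 'I_k -> 'I_l -> nat) : int :=
  \sum_(i < k) a i * \prod_(j < l) b i j ^+ alpha i j.

Definition solvable (k l : nat) (a : 'I_k -> int) (b : 'I_k -> 'I_l -> int)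
  (c : int) : Prop :=
  exists alpha : 'I_k -> 'I_l -> nat, expsum a b alpha = c.

Definition solvable_mod (k l : nat) (a : 'I_k -> int) (b : 'I_k -> 'I_l -> int)
  (m : nat) (c : int) : Prop :=
  exists alpha : 'I_k -> 'I_l -> nat, (expsum a b alpha = c %[mod m%:Z])%Z.

Definition H0set (k l : nat) (a : 'I_k -> int) (b : 'I_k -> 'I_l -> int)
  (c : int) : Prop := ~ solvable a b c.

Definition Hset (k l : nat) (a : 'I_k -> int) (b : 'I_k -> 'I_l -> int)
  (c : int) : Prop :=
  ~ solvable a b c /\ (forall m : nat, (2 <= m)%N -> solvable_mod a b m c).

Definition count_upto (P : int -> Prop) (n : nat) : nat :=
  size [seq c <- [seq (i%:Z - n%:Z) | i <- iota 0 (2 * n + 1)] | `[< P c >]].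

(* Main.v *)
Require Import Defs.
From HB Require Import structures.
From mathcomp Require Import all_boot all_order all_algebra.
From mathcomp Require Import all_classical all_reals all_analysis.
From mathcomp Require Import zify ring lra.
Import Order.TTheory GRing.Theory Num.Theory.
Import numFieldNormedType.Exports.

(** For every K and C there are a squarefree m and an L such that p - 1 | L for
    all primes p | m and C (L+1)^K <= m.  Modulo m a power b^n depends only on
    n = 0 or on n mod L, so the left-hand side of the congruence takes at most
    (L+1)^(kl) <= m / C values mod m.  Hence the locally solvable c have density
    zero, and H_0 has density one.

    To find m, let N = 2^(2h) and let m be the product of the primes
    sqrt N < p <= N such that p - 1 has no prime factor above N / 2^k, with k
    fixed in terms of K.  Then L can be taken close to lcm(1, ..., N / 2^k), so
    log L = O(N / 2^k), whereas log m >> N as soon as most primes up to N are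
    admissible.  An inadmissible prime is p = a q + 1 with q prime and a < 2^k;
    for fixed a, Brun's pure sieve together with Chebyshev's and Mertens'
    estimates bounds the number of those by o(N / log N). *)

(** * Chebyshev estimates *)

Lemma prod_primes_dvd (s : seq nat) (m : nat) :
  uniq s -> all prime s -> all (fun p => p %| m) s -> \prod_(p <- s) p %| m.
Proof.
elim: s => [|p s IHs] /=; first by rewrite big_nil dvd1n.
move=> /andP[ps us] /andP[pp sp] /andP[pm sm].
rewrite big_cons Gauss_dvd ?pm ?IHs // coprime_sym.
rewrite big_seq; apply: (big_ind (fun d => coprime d p)) => [|x y cx cy|q qs].
- exact: coprime1n.
- by rewrite coprimeMl cx cy.
- rewrite prime_coprime ?(allP sp q) // dvdn_prime2 ?(allP sp q) //.
  by apply: contraNneq ps => qp; rewrite -qp.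
Qed.

Lemma bin_le_exp (n m : nat) : 'C(n, m) <= 2 ^ n.
Proof.
elim: n m => [|n IHn] [|m]; rewrite ?bin0 ?expn_gt0 //.
by rewrite binS expnS mul2n -addnn leq_add.
Qed.

(** A prime in (n, 2n] divides (2n)! but not n!, so it divides the central binomial coefficient. *)
Lemma prime_prod_le (n : nat) :
  \prod_(n.+1 <= p < (2 * n).+1 | prime p) p <= 2 ^ (2 * n).
Proof.
apply: leq_trans (bin_le_exp (2 * n) n).
apply: dvdn_leq; first by rewrite bin_gt0; lia.
rewrite -big_filter; apply: prod_primes_dvd.
- by rewrite filter_uniq // iota_uniq.
- exact: filter_all.
apply/allP => p; rewrite mem_filter mem_index_iota => /andP[pp /andP[np p2n]].
have: p %| (2 * n)`! by rewrite dvdn_fact // (prime_gt0 pp) -ltnS.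
rewrite -(bin_fact (m := n)); last by lia.
have ->: 2 * n - n = n by lia.
have H k : k < p -> ~~ (p %| k`!).
  elim: k => [|k IH] kp; first by rewrite gtnNdvd // prime_gt1.
  by rewrite factS Euclid_dvdM // negb_or IH ?(ltnW kp) // andbT gtnNdvd.
by rewrite !Euclid_dvdM // (negPf (H n np)) !orbF.
Qed.

Lemma primorial_le (j : nat) :
  \prod_(0 <= p < (2 ^ j).+1 | prime p) p <= 2 ^ (2 ^ j.+1).
Proof.
elim: j => [|j IHj]; first by rewrite big_mkcond unlock.
rewrite (big_cat_nat (n := (2 ^ j).+1)) //=; last by rewrite ltnS leq_exp2l.
rewrite [in X in _ <= X]expnS mul2n -addnn expnD leq_mul //.
by rewrite [in X in X <= _]expnS expnS prime_prod_le.
Qed.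

(** Each prime of the block exceeds 2^j, and their product is bounded by [prime_prod_le]. *)
Lemma dyadic_count (j : nat) :
  j * count prime (index_iota (2 ^ j).+1 (2 ^ j.+1).+1) <= 2 ^ j.+1.
Proof.
rewrite -(leq_exp2l (m := 2)) //.
have := prime_prod_le (2 ^ j); rewrite -expnS; apply: leq_trans.
rewrite -big_filter -size_filter expnM.
set s := seq.filter _ _.
have: all (leq (2 ^ j)) s.
  by apply/allP => p; rewrite mem_filter mem_index_iota => /and3P[_ /ltnW].
elim: s => [|p s IHs] /=; first by rewrite big_nil expn0.
by case/andP=> jp sp; rewrite big_cons expnS leq_mul // IHs.
Qed.

(** By Legendre's formula the exponent of p is the sum over k of floor(2n/p^k) - 2 floor(n/p^k).
    Each term is at most 1 and vanishes once p^k > 2n. *)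
Lemma logn_central_bin (p n : nat) : prime p -> 0 < n ->
  p ^ logn p 'C(2 * n, n) <= 2 * n.
Proof.
move=> pp n0.
have n2 : 0 < 2 * n by lia.
apply: leq_trans (trunc_logP (prime_gt1 pp) n2).
rewrite leq_pexp2l ?prime_gt0 //.
have: logn p (2 * n)`! = logn p 'C(2 * n, n) + 2 * logn p n`!.
  rewrite -[in LHS](bin_fact (m := n)); last by lia.
  have ->: 2 * n - n = n by lia.
  rewrite lognM ?bin_gt0 ?muln_gt0 ?fact_gt0 ?lognM ?fact_gt0 //; lia.
rewrite logn_fact // [logn p n`!]logn_fact //.
have ->: \sum_(1 <= k < n.+1) n %/ p ^ k = \sum_(1 <= k < (2 * n).+1) n %/ p ^ k.
  rewrite [RHS](big_cat_nat (n := n.+1)) //=; last by lia.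
  rewrite [X in _ + X]big_nat_cond [X in _ + X]big1 ?addn0 // => k /andP[/andP[nk _] _].
  by rewrite divn_small //; apply: ltn_trans (ltn_expl k (prime_gt1 pp)).
rewrite big_distrr /=.
set t := trunc_log p (2 * n).
have tn : t < (2 * n).+1.
  rewrite ltnS /t; apply: leq_trans (trunc_logP (prime_gt1 pp) n2).
  exact: ltnW (ltn_expl _ (prime_gt1 pp)).
move=> E; rewrite -(leq_add2r (\sum_(1 <= i < (2 * n).+1) 2 * (n %/ p ^ i))) -E.
have ->: t = \sum_(1 <= k < t.+1) 1 by rewrite sum_nat_const_nat; lia.
have ->: \sum_(1 <= k < t.+1) 1 = \sum_(1 <= k < (2 * n).+1) (k <= t).
  rewrite [RHS](big_cat_nat (n := t.+1)) //=.
  rewrite [X in _ + X]big_nat_cond [X in _ + X]big1 ?addn0; last first.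
    by move=> k /andP[/andP[tk _] _]; rewrite leqNgt tk.
  by rewrite big_nat_cond [RHS]big_nat_cond; apply: eq_bigr => k /andP[/andP[_]]; rewrite ltnS => ->.
rewrite -big_split /=; apply: leq_sum => k _.
have pk: 0 < p ^ k by rewrite expn_gt0 prime_gt0.
case: (leqP k t) => kt /=.
  rewrite -ltnS ltn_divLR //.
  by have := ltn_ceil n pk; rewrite mulSn; nia.
rewrite divn_small //; apply: leq_trans (trunc_log_ltn _ (prime_gt1 pp)) _.
by rewrite leq_pexp2l // prime_gt0.
Qed.

(** Chebyshev's lower bound: 2^n <= C(2n, n), and C(2n, n) is a product of at most pi(2n) prime
    powers, each at most 2n. *)
Lemma prime_count_ge (n : nat) : 0 < n ->
  2 ^ n <= (2 * n) ^ count prime (iota 0 (2 * n).+1).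
Proof.
move=> n0.
have b0: 0 < 'C(2 * n, n) by rewrite bin_gt0; lia.
apply: (@leq_trans 'C(2 * n, n)).
  elim: n {n0 b0} => [|n IHn]; first by rewrite bin0.
  have ->: 2 * n.+1 = (2 * n).+2 by lia.
  have sym: 'C((2 * n).+1, n) = 'C((2 * n).+1, n.+1).
    by rewrite -bin_sub; [congr 'C(_, _); lia | lia].
  by rewrite expnS mul2n -addnn binS sym leq_add // (leq_trans IHn) // binS leq_addl.
rewrite [X in X <= _]prod_prime_decomp // prime_decompE big_map /=.
apply: (@leq_trans (\prod_(p <- primes 'C(2 * n, n)) (2 * n))).
  rewrite big_seq [X in _ <= X]big_seq; apply: leq_prod => p.
  by rewrite mem_primes => /andP[pp _]; exact: logn_central_bin.
rewrite big_const_seq iter_muln_1 count_predT leq_pexp2l ?muln_gt0 //.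
rewrite -size_filter uniq_leq_size ?primes_uniq // => p.
rewrite mem_primes mem_filter mem_iota => /and3P[pp _ pC]; rewrite pp /= ltnS.
rewrite prime_gt0 //=; apply: (leq_trans _ (logn_central_bin p _ pp n0)).
by rewrite -{1}[p]expn1 leq_pexp2l ?(prime_gt0 pp) // logn_gt0 mem_primes pp b0.
Qed.

(** * Brun's pure sieve *)

(** The shift D - 1 - (c mod D) makes the quotient jump exactly when the new element N lies in the
    class of c. *)
Lemma count_modE (D c N : nat) : 0 < D ->
  count (fun n => n == c %[mod D]) (iota 0 N) = (N + (D.-1 - c %% D)) %/ D.
Proof.
move=> D0; have cD := ltn_pmod c D0.
elim: N => [|N IHN]; first by rewrite divn_small //=; lia.
rewrite -addn1 iotaD count_cat IHN /= addn0 add0n.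
have -> : N + 1 + (D.-1 - c %% D) = (N + (D.-1 - c %% D)).+1 by lia.
rewrite divnS // addnC; congr (nat_of_bool _ + _).
have -> : (N + (D.-1 - c %% D)).+1 = N + (D - c %% D) by lia.
rewrite /dvdn -[0 in RHS](mod0n D) -[RHS](eqn_modDr (c %% D)) add0n.
rewrite -addnA subnK ?(ltnW cD) // -modnDmr modnn addn0 modn_mod.
by [].
Qed.

Lemma count_split3 (P Q Q1 Q2 : pred nat) (s : seq nat) :
  (forall n, (Q n = P n + Q1 n + Q2 n :> nat)) ->
  count Q s = count P s + count Q1 s + count Q2 s.
Proof. by move=> H; elim: s => //= n s ->; rewrite H; lia. Qed.

(** The progression c mod D is carried along because sifting by a further prime p removes
    progressions modulo D p. *)
Definition sifted (a : nat) (s : seq nat) (D c N : nat) : nat :=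
  count (fun n => (n == c %[mod D]) && all (fun p => ~~ (p %| n * (a * n + 1))) s)
    (iota 0 N).

(** A Buchstab-type identity: p | n (a n + 1) means n = 0 or n = u mod p, where a u = -1 mod p.
    These classes are disjoint, and the Chinese remainder theorem merges each with c mod D. *)
Lemma sifted_cons (a p : nat) (s : seq nat) (D c N : nat) :
  0 < D -> prime p -> ~~ (p %| a) -> coprime D p ->
  exists c1 c2, sifted a s D c N =
    sifted a (p :: s) D c N + sifted a s (D * p) c1 N + sifted a s (D * p) c2 N.
Proof.
move=> D0 pp pa Dp.
have cap : coprime a p by rewrite coprime_sym prime_coprime.
have p1 := prime_gt1 pp.
have [u pu] : exists u, p %| a * u + 1.
  have /dvdnP[u xu] : a %| chinese a p 0 p.-1.
    by rewrite /dvdn (chinese_modl cap) mod0n.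
  exists u; rewrite mulnC -xu /dvdn -modnDml (chinese_modr cap) modnDml.
  by rewrite addn1 prednK ?modnn // ltnW.
exists (chinese D p c 0), (chinese D p c u); apply: count_split3 => n /=.
rewrite !(chinese_remainder Dp) !(chinese_modl Dp) !(chinese_modr Dp).
rewrite Euclid_dvdM //.
have -> : (n == 0 %[mod p]) = (p %| n) by rewrite mod0n.
have -> : (n == u %[mod p]) = (p %| a * n + 1).
  have -> : (p %| a * n + 1) = (a * n + 1 == a * u + 1 %[mod p]) by rewrite (eqP pu).
  rewrite eqn_modDr; case/orP: (leq_total n u) => nu.
    rewrite eq_sym [RHS]eq_sym !eqn_mod_dvd ?leq_mul2l ?nu ?orbT // -mulnBr.
    by rewrite Gauss_dvdr // coprime_sym.
  rewrite !eqn_mod_dvd ?leq_mul2l ?nu ?orbT // -mulnBr.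
  by rewrite Gauss_dvdr // coprime_sym.
have: ~~ ((p %| n) && (p %| a * n + 1)).
  apply/negP => /andP[pn]; rewrite dvdn_addr ?dvdn_mull // dvdn1 => /eqP; lia.
by case: (p %| n); case: (p %| _); case: (_ == _ %[mod D]); case: all.
Qed.

Local Open Scope ring_scope.

Lemma prodr_ege1 (R : numDomainType) (I : Type) (r : seq I) (P : pred I) (F : I -> R) :
  (forall i, P i -> 1 <= F i) -> 1 <= \prod_(i <- r | P i) F i.
Proof.
move=> F1; elim/big_ind: _; [exact: lexx | exact: mulr_ege1 | exact: F1].
Qed.

(** Read y = 1/p, h = (-1)^r, g = 4^(-r), B = 2|s| + 1. The two level-r terms carry four times the
    weight of level r + 1, whence 1 + 8 y; moreover B^(r+1) + 2 B^r <= (B + 2)^(r+1). *)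
Lemma sieve_step (R : realFieldType) (B B' h g X y V P S S' S1 S2 : R) (r : nat) :
  0 <= B -> B' = B + 2 -> S = S' + S1 + S2 ->
  -1 * h * (S - X * V) <= B * B ^+ r + X * (4^-1 * g) * P ->
  h * (S1 - X * y * V) <= B ^+ r + X * y * g * P ->
  h * (S2 - X * y * V) <= B ^+ r + X * y * g * P ->
  -1 * h * (S' - X * ((1 - 2 * y) * V)) <=
  B' * B' ^+ r + X * (4^-1 * g) * ((1 + 8 * y) * P).
Proof.
move=> B0 -> -> I3 I1 I2.
have BB : B ^+ r <= (B + 2) ^+ r by apply: lerXn2r; rewrite ?nnegrE //; lra.
have {}BB : (B + 2) * B ^+ r <= (B + 2) * (B + 2) ^+ r by apply: ler_wpM2l; lra.
move: I3 I1 I2 BB; move: (B ^+ r) ((B + 2) ^+ r) => b b'; lra.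
Qed.

(** The sign makes this an upper bound for even r and a lower bound for odd r:
    sifting by one more prime subtracts two sifted counts, bounded at level r - 1.
    The factors 1 + 8 / p are Rankin's trick with weight 4 on the terms of the
    inclusion-exclusion that are truncated. *)
Lemma brun_sieve (R : realFieldType) (a N : nat) (s : seq nat) (r D c : nat) :
  (0 < D)%N -> uniq s -> all prime s -> all (fun p => ~~ (p %| a)%N) s ->
  all (coprime D) s ->
  (-1) ^+ r * ((sifted a s D c N)%:R -
      N%:R / D%:R * \prod_(p <- s) (1 - 2 / p%:R)) <=
  (2 * size s + 1)%:R ^+ r + N%:R / D%:R * 4^-1 ^+ r * \prod_(p <- s) (1 + 8 / p%:R) :> R.
Proof.
elim: s r D c => [|p s IHs] r D c D0.
  move=> _ _ _ _; rewrite !big_nil !mulr1 muln0 add0n expr1n.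
  rewrite /sifted (eq_count (a2 := fun n => n == c %[mod D])); last by move=> n /=; rewrite andbT.
  rewrite count_modE //; set q := (_ %/ D)%N.
  have q1 : (q * D <= N + D)%N.
    by rewrite /q; have := leq_trunc_div (N + (D.-1 - c %% D)) D; lia.
  have q2 : (N <= q * D + D)%N.
    by rewrite /q; have := ltn_ceil (N + (D.-1 - c %% D)) D0; lia.
  have DR : 0 < D%:R :> R by rewrite ltr0n.
  have H1 : q%:R <= N%:R / D%:R + 1 :> R.
    rewrite -(ler_pM2r DR) mulrDl divfK ?gt_eqF // mul1r -natrM -natrD ler_nat //.
  have H2 : N%:R / D%:R <= q%:R + 1 :> R.
    rewrite -(ler_pM2r DR) mulrDl divfK ?gt_eqF // mul1r -natrM -natrD ler_nat //.
  have H3 : 0 <= N%:R / D%:R * 4^-1 ^+ r :> R.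
    by rewrite mulr_ge0 ?divr_ge0 ?exprn_ge0 ?invr_ge0 ?ler0n.
  rewrite -signr_odd; case: (odd r); rewrite ?expr0 ?expr1; lra.
rewrite /= => /andP[ps us] /andP[pp sp] /andP[pa sa] /andP[Dp Ds].
have p2 : 2 <= p%:R :> R by rewrite ler_nat prime_gt1.
have V0 : 0 <= \prod_(q <- s) (1 - 2 / q%:R) :> R.
  rewrite big_seq; apply: prodr_ge0 => q qs.
  rewrite subr_ge0 ler_pdivrMr ?mul1r ?ltr0n ?prime_gt0 ?(allP sp) //.
  by rewrite ler_nat prime_gt1 ?(allP sp).
have V1 : \prod_(q <- s) (1 - 2 / q%:R) <= 1 :> R.
  rewrite big_seq; apply: prodr_ile1 => q qs; rewrite gerBl divr_ge0 // andbT.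
  rewrite subr_ge0 ler_pdivrMr ?mul1r ?ltr0n ?prime_gt0 ?(allP sp) //.
  by rewrite ler_nat prime_gt1 ?(allP sp).
have P1 : 1 <= \prod_(q <- s) (1 + 8 / q%:R) :> R.
  by apply: prodr_ege1 => q _; rewrite lerDl divr_ge0.
have Dps : all (coprime (D * p)) s.
  apply/allP => q qs; rewrite coprimeMl (allP Ds) //= prime_coprime //.
  by rewrite dvdn_prime2 ?(allP sp q) //; apply: contraNneq ps => ->.
have Dp0 : (0 < D * p)%N by rewrite muln_gt0 D0 prime_gt0.
have [c1 [c2 E]] := sifted_cons a p s D c N D0 pp pa Dp.
have ER := congr1 (fun x : nat => x%:R : R) E.
rewrite !natrD in ER.
have X0 : 0 <= N%:R / D%:R :> R by rewrite divr_ge0.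
set X := N%:R / D%:R in X0 *.
set V : R := \prod_(q <- s) (1 - 2 / q%:R) in V0 V1 *.
set P : R := \prod_(q <- s) (1 + 8 / q%:R) in P1 *.
rewrite !big_cons -/V -/P.
have y0 : 0 <= p%:R^-1 :> R by rewrite invr_ge0.
have y1 : p%:R^-1 <= 2^-1 :> R by rewrite lef_pV2 ?posrE //; lra.
have I1 := IHs _ _ c1 Dp0 us sp sa Dps.
have I2 := IHs _ _ c2 Dp0 us sp sa Dps.
have XE : N%:R / (D * p)%:R = X * p%:R^-1 :> R by rewrite natrM invfM mulrA.
rewrite XE -/V -/P in I1 I2.
set y := p%:R^-1 in y0 y1 XE I1 I2 *.
case: r => [|r].
  (* At level 0 the two subtracted counts are discarded, being non-negative. *)
  have I3 := IHs 0%N D c D0 us sp sa Ds.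
  rewrite !expr0 !mul1r !mulr1 -/X -/V -/P in I3 *.
  have H : 0 <= X * y * (8 * P - 2 * V) by apply: mulr_ge0; [exact: mulr_ge0 | lra].
  have S0 : 0 <= (sifted a s (D * p) c1 N)%:R :> R by rewrite ler0n.
  have S0' : 0 <= (sifted a s (D * p) c2 N)%:R :> R by rewrite ler0n.
  lra.
have I3 := IHs r.+1 D c D0 us sp sa Ds.
rewrite -/X -/V -/P !exprS in I3; rewrite !exprS.
have B0 : 0 <= (2 * size s + 1)%:R :> R by rewrite ler0n.
have B2 : (2 * (size s).+1 + 1)%:R = (2 * size s + 1)%:R + 2 :> R.
  by rewrite mulnS -addnA addnC natrD.
exact: (sieve_step _ _ _ _ _ _ _ _ _ _ _ _ _ r B0 B2 ER I3 (I1 r) (I2 r)).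
Qed.

(** * Mertens products *)

Lemma bernoulli_le (R : realFieldType) (x : R) (n : nat) : 0 <= x ->
  1 + n%:R * x <= (1 + x) ^+ n.
Proof.
move=> x0; elim: n => [|n IHn]; first by rewrite mul0r addr0 expr0.
have H : (1 + x) * (1 + n%:R * x) <= (1 + x) ^+ n.+1 by rewrite exprS ler_wpM2l //; lra.
apply: le_trans H; rewrite -natr1.
have : 0 <= n%:R * x ^+ 2 by rewrite mulr_ge0 ?sqr_ge0.
rewrite expr2; lra.
Qed.

Lemma exprD1_upper (R : realFieldType) (x : R) (n : nat) : 0 <= x ->
  (1 + x) ^+ n * (1 - n%:R * x) <= 1.
Proof.
move=> x0; elim: n => [|n IHn]; first by rewrite mul0r subr0 expr0 mulr1.
apply: le_trans IHn; rewrite exprSr -mulrA ler_wpM2l ?exprn_ge0 ?addr_ge0 //.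
rewrite -natr1.
have : 0 <= (n%:R + 1) * x ^+ 2 by rewrite mulr_ge0 ?sqr_ge0 ?addr_ge0.
rewrite expr2; lra.
Qed.

(** With x = 2^(-j) and c primes in the block, the product is at most (1 + 8 x)^c. Its j-th power is
    at most 2^32 <= ((1 + 1/j)^j)^32, by c j <= 2^(j+1) and (1 + x)^(2^(j-1)) <= 2. *)
Lemma dyadic_prod_le (R : realFieldType) (j : nat) : (0 < j)%N ->
  \prod_((2 ^ j).+1 <= p < (2 ^ j.+1).+1 | prime p) (1 + 8 / p%:R) <=
  (1 + j%:R^-1) ^+ 32 :> R.
Proof.
move=> j0; set c := count prime (index_iota (2 ^ j).+1 (2 ^ j.+1).+1).
have m0 : 0 < (2 ^ j)%:R :> R by rewrite ltr0n expn_gt0.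
set x : R := (2 ^ j)%:R^-1.
have x0 : 0 <= x by rewrite invr_ge0 ltW.
apply: (@le_trans _ _ ((1 + 8 * x) ^+ c)).
  rewrite -big_filter /c -size_filter; set s := seq.filter _ _.
  have : all (leq (2 ^ j)) s.
    by apply/allP => p; rewrite mem_filter mem_index_iota => /and3P[_ /ltnW].
  elim: s => [|p s IHs] /=; first by rewrite big_nil expr0.
  case/andP=> jp sp; rewrite big_cons exprS; apply: ler_pM.
  - by rewrite addr_ge0 // divr_ge0.
  - by apply: prodr_ge0 => q _; rewrite addr_ge0 // divr_ge0.
  - rewrite lerD2l ler_wpM2l // lef_pV2 ?posrE ?ler_nat //.
    by rewrite ltr0n (leq_trans _ jp) // expn_gt0.
  - exact: IHs.
have j0R : 0 < j%:R :> R by rewrite ltr0n.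
have jV : 0 <= j%:R^-1 :> R by rewrite invr_ge0 ltW.
rewrite -(ler_pXn2r j0) ?nnegrE ?exprn_ge0 ?addr_ge0 ?mulr_ge0 //.
apply: (@le_trans _ _ (2 ^+ 32)); last first.
  rewrite -exprM mulnC exprM lerXn2r ?nnegrE ?exprn_ge0 ?addr_ge0 //.
  by apply: le_trans (bernoulli_le _ _ j jV); rewrite divff ?gt_eqF.
have h1 : 1 <= 1 + x by lra.
have H8 : 1 + 8 * x <= (1 + x) ^+ 8 by apply: bernoulli_le.
have {}H8 : (1 + 8 * x) ^+ c ^+ j <= (1 + x) ^+ (8 * (c * j)).
  by rewrite -exprM [X in _ <= X]exprM lerXn2r ?nnegrE ?exprn_ge0 ?addr_ge0 ?mulr_ge0.
apply: le_trans H8 _.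
have cj : (8 * (c * j) <= 2 ^ j.-1 * 32)%N.
  have := dyadic_count j; rewrite -/c; rewrite -{2}(prednK j0) !expnS; nia.
apply: (@le_trans _ _ ((1 + x) ^+ (2 ^ j.-1 * 32))).
  exact: ler_weXn2l.
rewrite exprM lerXn2r ?nnegrE ?exprn_ge0 ?addr_ge0 //.
have := exprD1_upper _ x (2 ^ j.-1) x0.
have -> : (2 ^ j.-1)%:R * x = 2^-1 :> R.
  by rewrite /x -{2}(prednK j0) expnS natrM invfM mulrCA divff ?mulr1 // pnatr_eq0 expn_eq0.
lra.
Qed.

(** The block factors (1 + 1/j)^32 telescope to J^32; the constant 5 = 1 + 8/2 is the factor of p =
    2. *)
Lemma prime_prod_upper (R : realFieldType) (J : nat) : (0 < J)%N ->
  \prod_(0 <= p < (2 ^ J).+1 | prime p) (1 + 8 / p%:R) <= 5 * J%:R ^+ 32 :> R.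
Proof.
elim: J => // -[|J] IHJ _.
  rewrite big_mkcond /= /index_iota /= !big_cons big_nil /=; rewrite !expr1n; lra.
rewrite (big_cat_nat (n := (2 ^ J.+1).+1)) //=; last by rewrite ltnS leq_exp2l.
have p0 m n : 0 <= \prod_(m <= p < n | prime p) (1 + 8 / p%:R) :> R.
  by apply: prodr_ge0 => q _; rewrite addr_ge0 // divr_ge0.
have -> : J.+2%:R = J.+1%:R * (1 + J.+1%:R^-1) :> R.
  by rewrite mulrDr mulr1 divff ?pnatr_eq0 // natr1.
rewrite exprMn mulrA ler_pM ?p0 ?IHJ //.
exact: dyadic_prod_le.
Qed.

Lemma sum_nat_dvd (R : realFieldType) (p z : nat) (F : nat -> R) : (0 < p)%N ->
  \sum_(1 <= n < z.+1 | (p %| n)%N) F n = \sum_(1 <= n < (z %/ p).+1) F (p * n)%N.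
Proof.
move=> p0; elim: z => [|z IHz]; first by rewrite div0n !big_geq.
rewrite big_mkcond big_nat_recr //= -big_mkcond IHz divnS //.
case: ifP => [pz|_]; last by rewrite addr0.
rewrite add1n [RHS]big_nat_recr //=; congr (_ + F _).
by have := divnK pz; rewrite divnS // pz add1n mulnC => ->.
Qed.

(** A truncation of the Euler product of 1 / (1 - 1/p) over p in s. *)
Definition smooth_sum (R : realFieldType) (s : seq nat) (z : nat) : R :=
  \sum_(1 <= n < z.+1 | all [in s] (primes n)) n%:R^-1.

(** Split the n in the left-hand sum according to whether p | n. *)
Lemma smooth_sum_cons (R : realFieldType) (p : nat) (s : seq nat) (z : nat) :
  prime p -> smooth_sum R (p :: s) z * (1 - p%:R^-1) <= smooth_sum R s z.
Proof.
move=> pp; rewrite mulrBr mulr1 lerBlDr.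
rewrite {1}/smooth_sum (bigID (fun n => (p %| n)%N)) /= addrC lerD //.
  rewrite /smooth_sum big_mkcond [X in _ <= X]big_mkcond /=.
  rewrite big_nat_cond [X in _ <= X]big_nat_cond; apply: ler_sum => n /andP[/andP[n0 _] _].
  case: ifP => [/andP[sn pn]|_]; last by case: ifP => // _; rewrite invr_ge0.
  rewrite ifT //; apply/allP => q qn; have := allP sn _ qn.
  by rewrite inE => /orP[/eqP qp|//]; move: qn pn; rewrite qp mem_primes => /and3P[_ _ ->].
rewrite (eq_bigl (fun n => (p %| n)%N && all [in p :: s] (primes n))); last by move=> n; rewrite andbC.
rewrite big_mkcondr sum_nat_dvd ?prime_gt0 //.
rewrite /smooth_sum mulr_suml [X in _ <= X]big_mkcond /=.
rewrite [X in _ <= X](big_cat_nat (n := (z %/ p).+1)) //=; last by rewrite ltnS leq_div.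
rewrite -[X in X <= _]addr0 lerD //; last first.
  by apply: sumr_ge0 => n _; case: ifP => // _; rewrite mulr_ge0 ?invr_ge0.
rewrite le_eqVlt; apply/orP; left; apply/eqP.
rewrite big_nat_cond [RHS]big_nat_cond; apply: eq_bigr => n /andP[/andP[n0 _] _].
have -> : all [in p :: s] (primes (p * n)) = all [in p :: s] (primes n).
  apply/allP/allP => H q qn.
    by apply: H; rewrite primesM ?(prime_gt0 pp) // qn orbT.
  move: qn; rewrite primesM ?(prime_gt0 pp) // primes_prime // => /orP[|/H //].
  by rewrite !inE => ->.
by case: ifP => // _; rewrite natrM invfM mulrC.
Qed.

Lemma harmonic_ge (R : realFieldType) (J : nat) :
  J%:R / 2 <= \sum_(1 <= n < (2 ^ J).+1) n%:R^-1 :> R.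
Proof.
elim: J => [|J IHJ]; first by rewrite mul0r big_nat1 invr_ge0.
rewrite (big_cat_nat (n := (2 ^ J).+1)) //=; last by rewrite ltnS leq_exp2l.
rewrite -natr1 mulrDl lerD //.
apply: (@le_trans _ _ (\sum_((2 ^ J).+1 <= n < (2 ^ J.+1).+1) (2 ^ J.+1)%:R^-1)); last first.
  apply: ler_sum_nat => n /andP[n0 n1].
  by rewrite lef_pV2 ?posrE ?ltr0n ?expn_gt0 ?ler_nat // (leq_trans _ n0).
have E : (2 ^ J.+1 - 2 ^ J = 2 ^ J)%N by rewrite expnS mul2n -addnn addnK.
rewrite sumr_const_nat subSS E -[X in _ <= X]mulr_natl expnS natrM invfM mulrCA.
by rewrite divff ?mulr1 ?div1r // pnatr_eq0 expn_eq0.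
Qed.

(** All n <= 2^J have their prime factors up to 2^J, so the smooth sum contains the whole harmonic
    sum, which is at least J / 2. Removing the primes one by one leaves only the term n = 1. *)
Lemma prime_prod_inv_le (R : realFieldType) (J : nat) :
  J%:R / 2 * \prod_(0 <= p < (2 ^ J).+1 | prime p) (1 - p%:R^-1) <= 1 :> R.
Proof.
have key (s : seq nat) z : all prime s ->
    smooth_sum R s z * \prod_(p <- s) (1 - p%:R^-1) <= 1.
  elim: s => [|p s IHs] /=.
    move=> _; rewrite big_nil mulr1 /smooth_sum.
    case: z => [|z]; first by rewrite big_geq.
    rewrite big_ltn_cond //= invr1 big_nat_cond big1 ?addr0 // => n /andP[/andP[n1 _]].
    move=> H; suff: primes n == [::] by rewrite primes_eq0 ltnNge n1.
    by case: (primes n) H.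
  case/andP=> pp sp; rewrite big_cons mulrA; apply: le_trans (IHs sp).
  apply: ler_wpM2r (smooth_sum_cons _ _ _ _ pp).
  rewrite big_seq; apply: prodr_ge0 => q qs.
  rewrite subr_ge0 invf_le1 ?ltr0n ?ler1n ?prime_gt0 ?(allP sp) //.
rewrite -big_filter; apply: le_trans (key _ (2 ^ J)%N (filter_all _ _)).
apply: ler_wpM2r.
  rewrite big_seq; apply: prodr_ge0 => q; rewrite mem_filter => /andP[qp _].
  by rewrite subr_ge0 invf_le1 ?ltr0n ?ler1n ?prime_gt0.
apply: le_trans (harmonic_ge _ _) _.
rewrite /smooth_sum [X in _ <= X]big_mkcond /= big_nat_cond [X in _ <= X]big_nat_cond.
apply: ler_sum => n /andP[/andP[n0 n1] _]; rewrite ifT //.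
apply/allP => q; rewrite mem_primes => /and3P[qp _ qn].
by rewrite mem_filter mem_iota qp prime_gt0 //= add1n (leq_ltn_trans (dvdn_leq n0 qn)).
Qed.

(** Since 1 - 2/p <= (1 - 1/p)^2, the previous bound is squared. The fixed product over the primes
    up to A, which may divide the coefficient a, goes into C. *)
Lemma sifting_density_le (R : realFieldType) (A : nat) :
  exists2 C : R, 0 < C & forall J, (0 < J)%N -> (A <= 2 ^ J)%N ->
    \prod_(A.+1 <= p < (2 ^ J).+1 | prime p) (1 - 2 / p%:R) <= C / J%:R ^+ 2.
Proof.
have f0 p : prime p -> 0 < 1 - p%:R^-1 :> R.
  by move=> pp; rewrite subr_gt0 invf_lt1 ?ltr0n ?ltr1n ?prime_gt1 ?prime_gt0.
set c : R := \prod_(0 <= p < A.+1 | prime p) (1 - p%:R^-1).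
have c0 : 0 < c by apply: prodr_gt0.
exists ((2 / c) ^+ 2); first by rewrite exprn_gt0 // divr_gt0.
move=> J J0 AJ.
have J0R : 0 < J%:R :> R by rewrite ltr0n.
set Q : R := \prod_(A.+1 <= p < (2 ^ J).+1 | prime p) (1 - p%:R^-1).
have Q0 : 0 < Q by apply: prodr_gt0.
have QJ : Q <= 2 / c / J%:R.
  have := prime_prod_inv_le R J.
  rewrite (big_cat_nat (n := A.+1)) //= -/c -/Q => H.
  by rewrite ler_pdivlMr // ler_pdivlMr //; lra.
apply: (@le_trans _ _ (Q ^+ 2)); last first.
  rewrite -expr_div_n; apply: lerXn2r; rewrite ?nnegrE ?(ltW Q0) //.
  by rewrite !divr_ge0 // ltW.
rewrite -prodrXl.
apply: ler_prod => p pp; rewrite expr2.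
have p2 : p%:R^-1 <= 2^-1 :> R by rewrite lef_pV2 ?posrE ?ltr0n ?ler_nat ?prime_gt0 ?prime_gt1.
have p0 : 0 <= p%:R^-1 :> R by rewrite invr_ge0.
by apply/andP; split; nra.
Qed.

(** * Primes q such that a q + 1 is prime *)

Definition chain_count (a N : nat) : nat :=
  count (fun q => prime q && prime (a * q + 1)) (iota 0 N).

Lemma count_iota_leq (z N : nat) : (count (fun q => q <= z) (iota 0 N) <= z.+1)%N.
Proof.
rewrite -size_filter -[X in (_ <= X)%N](size_iota 0); apply: uniq_leq_size.
  by rewrite filter_uniq // iota_uniq.
by move=> q; rewrite mem_filter !mem_iota ltnS => /andP[].
Qed.

(** If q > z and both q and a q + 1 are prime, no prime up to z divides q (a q + 1). The q <= z
    account for z + 1. *)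
Lemma chain_count_le_sifted (a A z N : nat) : (0 < a)%N ->
  (chain_count a N <=
    z.+1 + sifted a [seq p <- index_iota A.+1 z.+1 | prime p] 1 0 N)%N.
Proof.
move=> a0; rewrite -(leq_add2l 0) add0n.
apply: leq_trans (leq_add (count_iota_leq z N) (leqnn _)).
rewrite /chain_count /sifted -count_predUI; apply: leq_trans (leq_addr _ _).
apply: sub_count => q /andP[qp aqp] /=; rewrite !modn1 eqxx /=.
case: leqP => //= zq; apply/allP => p.
rewrite mem_filter mem_index_iota ltnS => /andP[pp /andP[_ pz]].
have qq : (q < a * q + 1)%N by rewrite addn1 ltnS leq_pmull.
have pq := leq_ltn_trans pz zq.
rewrite Euclid_dvdM // !dvdn_prime2 // negb_or !neq_ltn pq.
by rewrite (ltn_trans pq qq).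
Qed.

(** [brun_sieve] at even r with the primes in (A, 2^J]: none of them divides a <= A, and there are
    at most 2^J. *)
Lemma chain_count_sieve (R : realFieldType) (A : nat) :
  exists2 C : R, 0 < C & forall J r a N : nat,
    (0 < J)%N -> (A <= 2 ^ J)%N -> ~~ odd r -> (0 < a <= A)%N ->
    (chain_count a N)%:R <= ((2 ^ J).+1 + (2 * 2 ^ J + 1) ^ r)%:R
      + N%:R * (C / J%:R ^+ 2 + 4^-1 ^+ r * (5 * J%:R ^+ 32)) :> R.
Proof.
have [C C0 HC] := sifting_density_le R A; exists C => // J r a N J0 AJ er /andP[a0 aA].
set s := [seq p <- index_iota A.+1 (2 ^ J).+1 | prime p].
have us : uniq s by rewrite filter_uniq // iota_uniq.
have sp : all prime s by exact: filter_all.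
have sa : all (fun p => ~~ (p %| a)%N) s.
  apply/allP => p; rewrite mem_filter mem_index_iota => /and3P[_ Ap _].
  by rewrite gtnNdvd // (leq_ltn_trans aA Ap).
have s1 : all (coprime 1) s by apply/allP => p _; exact: coprime1n.
have ss : (size s <= 2 ^ J)%N.
  have -> : (2 ^ J = size (iota 1 (2 ^ J)))%N by rewrite size_iota.
  apply: uniq_leq_size us _ => p; rewrite mem_filter mem_index_iota mem_iota.
  by case/and3P=> pp _ pJ; rewrite prime_gt0 // add1n.
have H := brun_sieve R a N s r 1 0 isT us sp sa s1.
rewrite -signr_odd (negPf er) expr0 mul1r divr1 in H.
have V := HC J J0 AJ; rewrite -big_filter -/s in V.
have P : \prod_(p <- s) (1 + 8 / p%:R) <= 5 * J%:R ^+ 32 :> R.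
  apply: le_trans (prime_prod_upper R J J0).
  rewrite [X in _ <= X](big_cat_nat (n := A.+1)) //= big_filter.
  rewrite -[X in X <= _]mul1r ler_wpM2r //.
    by apply: prodr_ge0 => p _; rewrite addr_ge0 // divr_ge0.
  by apply: prodr_ege1 => p _; rewrite lerDl divr_ge0.
have S : (chain_count a N)%:R <= (2 ^ J).+1%:R + (sifted a s 1 0 N)%:R :> R.
  by rewrite -natrD ler_nat chain_count_le_sifted.
have B : (2 * size s + 1)%:R ^+ r <= ((2 * 2 ^ J + 1) ^ r)%:R :> R.
  rewrite -natrX ler_nat; case: (r) => // r1.
  by rewrite leq_exp2r // leq_add2r leq_mul2l ss.
apply: le_trans S _; rewrite natrD -addrA lerD2l.
have N0 : 0 <= N%:R :> R by rewrite ler0n.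
have g0 : 0 <= 4^-1 ^+ r :> R by rewrite exprn_ge0 ?invr_ge0.
have {}V := ler_wpM2l N0 V.
have {}P := ler_wpM2l (mulr_ge0 N0 g0) P.
rewrite mulrDr mulrA.
move: H V P B N0; move: (\prod_(p <- s) _) (\prod_(p <- s) _) ((sifted _ _ _ _ _)%:R) => v p S.
move: (_ ^+ r) (_ ^+ r) => g b; lra.
Qed.

Local Open Scope nat_scope.

Lemma sqr_le_exp2 (t : nat) : 4 <= t -> t * t <= 2 ^ t.
Proof.
elim: t => // t IHt; rewrite leq_eqVlt => /orP[/eqP <- //|t4].
by have := IHt t4; rewrite expnS; nia.
Qed.

(** With J = 2^t and r = 18 t, the sieve error is 2^(J r) up to a factor 2^(O(r)), while N = 2^(2 J
    r); so even J log_2 N times the error stays below N. *)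
Lemma sieve_error_le (t : nat) : 2 <= t ->
  36 * t * 2 ^ t * ((2 ^ (2 ^ t)).+1 + (2 * 2 ^ (2 ^ t) + 1) ^ (18 * t)) * 2 ^ t
  <= 2 ^ (36 * t * 2 ^ t).
Proof.
move=> t2; set J := 2 ^ t; set r := 18 * t.
have J4 : 4 <= J by rewrite /J -[4]/(2 ^ 2) leq_exp2l.
have r1 : 2 * t + 2 <= r by rewrite /r; lia.
have r0 : 0 < r by lia.
have H1 : (2 * 2 ^ J + 1) ^ r <= 2 ^ ((J + 2) * r).
  rewrite expnM; rewrite leq_exp2r // expnD.
  by have := expn_gt0 2 J; lia.
have H2 : (2 ^ J).+1 <= 2 ^ ((J + 2) * r).
  apply: (@leq_trans (2 ^ (J + 2))); last by rewrite leq_pexp2l // leq_pmulr.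
  by rewrite expnD; have := expn_gt0 2 J; lia.
have H3 : 36 * t * J * J <= 2 ^ (2 * t + 1 + r).
  have rr := ltn_expl r (isT : 1 < 2).
  rewrite mul2n -addnn (expnD _ (_ + _)) (expnD _ _ 1) (expnD _ t) expn1.
  rewrite (_ : 36 * t * J * J = J * J * (36 * t)); last by lia.
  rewrite -[X in _ <= X]mulnA leq_mul2l; apply/orP; right.
  by rewrite (_ : 36 * t = 2 * r) ?leq_mul2l ?(ltnW rr) ?orbT // /r; lia.
have -> x : 36 * t * J * x * J = 36 * t * J * J * x by lia.
apply: leq_trans (leq_mul H3 (leq_add H2 H1)) _.
rewrite addnn -mul2n -expnS -expnD leq_pexp2l //.
have -> : 36 * t * J = 2 * J * r by rewrite /r; lia.
nia.
Qed.

Local Open Scope ring_scope.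

(** With M = 36 t J, the error satisfies M E <= N / J <= N / t, and the main term contributes 36 (C
    + 5) N t / J <= 36 (C + 5) N / t because t^2 <= J. *)
Lemma chain_count_estimate (R : realFieldType) (c E N C t J e : R) :
  1 <= t -> t * t <= J -> 0 <= E -> 0 <= N -> 0 < C -> 0 <= e ->
  c <= E + N * (C / J ^+ 2 + (J ^+ 36)^-1 * (5 * J ^+ 32)) ->
  36 * t * J * E * J <= N -> e * (1 + 36 * (C + 5)) <= t ->
  e * (36 * t * J) * c <= N.
Proof.
move=> t1 tJ E0 N0 C0 e0 cE EN et.
have t0 : 0 < t by lra.
have J1 : 1 <= J by nra.
have J0 : 0 < J by lra.
have Jn : J != 0 by rewrite gt_eqF.
have JtJ : J^-1 * t <= t^-1.
  by rewrite mulrC ler_pdivrMr // ler_pdivlMl.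
have E36 : (J ^+ 36)^-1 * (5 * J ^+ 32) <= 5 / J ^+ 2.
  have -> : (J ^+ 36)^-1 * (5 * J ^+ 32) = 5 / J ^+ 4 by field.
  by rewrite ler_pM2l // lef_pV2 ?posrE ?exprn_gt0 // ler_weXn2l.
have m0 : 0 <= 36 * t * J by rewrite !mulr_ge0 // ltW.
have mE : 36 * t * J * E <= N / t.
  apply: (@le_trans _ _ (N / J)); first by rewrite ler_pdivlMr.
  by rewrite ler_wpM2l // lef_pV2 ?posrE //; nra.
have mN : 36 * t * J * (N * ((C + 5) / J ^+ 2)) <= 36 * (C + 5) * (N / t).
  have -> : 36 * t * J * (N * ((C + 5) / J ^+ 2)) = 36 * (C + 5) * (N * (J^-1 * t)) by field.
  by rewrite !ler_wpM2l //; lra.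
have mc : 36 * t * J * c <= (1 + 36 * (C + 5)) * (N / t).
  have c' : c <= E + N * ((C + 5) / J ^+ 2).
    apply: le_trans cE _; rewrite lerD2l; apply: ler_wpM2l => //.
    by rewrite [X in _ <= X]mulrDl lerD2l.
  have := ler_wpM2l m0 c'; rewrite mulrDr; lra.
rewrite -mulrA; apply: le_trans (ler_wpM2l e0 mc) _.
rewrite (mulrA e); apply: (@le_trans _ _ (t * (N / t))).
  by apply: ler_wpM2r => //; rewrite divr_ge0 // ltW.
by rewrite mulrC divfK // gt_eqF.
Qed.

(** The sieve parameters are J = 2^t (sifting by primes up to 2^J) and r = 18 t, so
    that 4^r = J^36 absorbs J^32; the length is 2^M with M = 2 J r. *)
Lemma chain_count_rare (R : archiRealFieldType) (A e : nat) :
  exists t0, forall t a, (t0 <= t)%N -> (0 < a <= A)%N ->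
    (e * (36 * t * 2 ^ t) * chain_count a (2 ^ (36 * t * 2 ^ t))
      <= 2 ^ (36 * t * 2 ^ t))%N.
Proof.
have [C C0 HC] := chain_count_sieve R A.
set B : R := e%:R * (1 + 36 * (C + 5)).
have B0 : 0 <= B by rewrite /B mulr_ge0 //; lra.
(* [Num.bound B] makes t exceed e (1 + 36 (C + 5)), A ensures A <= 2^(2^t), and 4 gives t^2 <=
   2^t. *)
exists (Num.bound B + A + 4)%N => t a tt aA.
have tB : B <= t%:R.
  apply: ltW; apply: lt_le_trans (archi_boundP B0) _.
  by rewrite ler_nat; apply: leq_trans tt; rewrite -addnA leq_addr.
have tA : (A <= t)%N by apply: leq_trans tt; rewrite addnAC leq_addl.
have t4 : (4 <= t)%N by apply: leq_trans tt; rewrite leq_addl.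
clear tt.
have er : ~~ odd (18 * t) by rewrite oddM.
have J0 : (0 < 2 ^ t)%N by rewrite expn_gt0.
have AJ : (A <= 2 ^ (2 ^ t))%N.
  by rewrite (leq_trans tA) // ltnW // (ltn_trans (ltn_expl t (isT : 1 < 2)%N)) // ltn_expl.
have cE := HC (2 ^ t)%N (18 * t)%N a (2 ^ (36 * t * 2 ^ t))%N J0 AJ er aA.
have EN := sieve_error_le t (ltnW (ltnW t4)).
have tJ := sqr_le_exp2 t t4.
have J36 : ((2 ^ t) ^ 36 = 4 ^ (18 * t))%N.
  by rewrite -expnM (_ : 4 = 2 ^ 2)%N // -expnM mulnA mulnC.
have N0 : (0 < 2 ^ (36 * t * 2 ^ t))%N by rewrite expn_gt0.
move: J0 cE EN tJ J36 N0 {AJ}.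
move: (chain_count a _) => c; move: (2 ^ (36 * t * 2 ^ t))%N => N.
move: ((2 ^ (2 ^ t)).+1 + (2 * 2 ^ (2 ^ t) + 1) ^ (18 * t))%N => E.
move: (2 ^ t)%N => J.
move=> J0 cE EN tJ J36 N0; clear -J36 J0 cE EN tJ N0 tB t4 C0.
rewrite -(ler_nat R) !natrM; apply: (chain_count_estimate _ c%:R E%:R _ C);
  rewrite ?ler1n ?ler0n ?ltr0n ?(ltnW (ltnW (ltnW t4))) //.
- by rewrite -natrM ler_nat.
- have -> : (J%:R ^+ 36)^-1 = 4^-1 ^+ (18 * t) :> R by rewrite exprVn -natrX J36 natrX.
  exact: cE.
- by rewrite -!natrM ler_nat.
Qed.

(** * Moduli with small exponent *)

Local Open Scope nat_scope.

Definition friable_primes (h k : nat) : seq nat :=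
  [seq p <- index_iota (2 ^ h).+1 (2 ^ (2 * h)).+1 |
    prime p && all (fun q => q <= 2 ^ (2 * h - k)) (primes p.-1)].

(** Let N = 2^(2h). A prime p in (2^h, N] missing from the list has p - 1 = a q with a prime q > N /
    2^k, hence a <= 2^k, and q is counted by [chain_count a N]. *)
Lemma friable_primes_count (h k : nat) : k <= 2 * h ->
  count prime (iota 0 (2 ^ (2 * h)).+1) <=
  (2 ^ h).+1 + size (friable_primes h k) +
  \sum_(a <- iota 1 (2 ^ k)) chain_count a (2 ^ (2 * h)).
Proof.
move=> kh; set N := 2 ^ (2 * h).
pose bad a := [seq a * q + 1 | q <- iota 0 N & prime q && prime (a * q + 1)].
have -> : \sum_(a <- iota 1 (2 ^ k)) chain_count a N
          = size (flatten [seq bad a | a <- iota 1 (2 ^ k)]).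
  rewrite size_flatten sumnE !big_map; apply: eq_bigr => a _.
  by rewrite size_map size_filter.
rewrite -[(2 ^ h).+1](size_iota 0) -!size_cat -size_filter.
apply: uniq_leq_size => [|p]; first by rewrite filter_uniq // iota_uniq.
rewrite mem_filter mem_iota ltnS => /and3P[pp _ pN].
rewrite !mem_cat mem_iota /= add0n ltnS; case: leqP => //= hp.
rewrite mem_filter pp mem_index_iota ltnS hp pN andbT.
case: allP => //= /allP; rewrite -has_predC => /hasP[q] /=.
rewrite mem_primes -ltnNge => /and3P[qp p0 /dvdnP[a pa]] kq.
have p1 : p = a * q + 1 by rewrite -pa addn1 prednK // prime_gt0.
have a0 : 0 < a by move: p0; rewrite pa; case: (a).
have qN : q < N.
  apply: leq_trans pN; rewrite p1 addn1 ltnS leq_pmull //.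
apply/flattenP; exists (bad a); last first.
  by rewrite p1; apply: map_f; rewrite mem_filter mem_iota qp -p1 pp.
apply: map_f; rewrite mem_iota a0 add1n ltnS /=.
rewrite -(leq_pmul2r (prime_gt0 qp)) -pa; apply: (@leq_trans N).
  by rewrite (leq_trans _ pN) // leq_pred.
rewrite /N -(subnKC kh) expnD leq_mul2l; apply/orP; right.
exact: ltnW.
Qed.

(** The least common multiple of the positive integers up to 2^(2h) whose prime factors are all at
    most [2 ^ (2 * h - k)]. *)
Definition friable_exponent (h k : nat) : nat :=
  \prod_(0 <= q < (2 ^ (2 * h - k)).+1 | prime q) q ^ trunc_log q (2 ^ (2 * h)).

Lemma friable_exponent_gt0 (h k : nat) : 0 < friable_exponent h k.
Proof. by apply: prodn_cond_gt0 => q qp; rewrite expn_gt0 prime_gt0. Qed.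

Lemma friable_exponent_dvd (h k p : nat) :
  p \in friable_primes h k -> p.-1 %| friable_exponent h k.
Proof.
rewrite mem_filter mem_index_iota ltnS => /andP[/andP[pp /allP pf] /andP[_ pN]].
have p0 : 0 < p.-1 by rewrite -subn1 subn_gt0 prime_gt1.
apply/dvdn_partP => // q qp1; have qk := pf q qp1.
move: qp1; rewrite mem_primes => /and3P[qp _ qp1].
have N0 : 0 < 2 ^ (2 * h) by rewrite expn_gt0.
rewrite p_part; apply: (@dvdn_trans (q ^ trunc_log q (2 ^ (2 * h)))).
  rewrite dvdn_exp2l // trunc_log_max ?prime_gt1 //.
  apply: (@leq_trans p.-1); first by rewrite dvdn_leq // pfactor_dvdnn.
  by rewrite (leq_trans _ pN) // leq_pred.
rewrite /friable_exponent -big_filter (big_rem q) ?dvdn_mulr //=.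
by rewrite mem_filter mem_iota qp prime_gt0 //= add1n ltnS.
Qed.

(** A prime q <= 2^h contributes at most 2^(2h). A larger one has q^2 > 2^(2h), so its exponent is
    at most 1 and the primorial bound applies. *)
Lemma friable_exponent_le (h k : nat) :
  friable_exponent h k <= 2 ^ (2 * h * (2 ^ h).+1 + 2 ^ (2 * h - k).+1).
Proof.
rewrite expnD.
apply: leq_trans (leq_mul (leqnn _) (primorial_le (2 * h - k))).
set Z := (2 ^ (2 * h - k)).+1.
apply: (@leq_trans (\prod_(0 <= q < Z | prime q)
   ((if q <= 2 ^ h then 2 ^ (2 * h) else 1) * q))).
  apply: leq_prod => q qp; case: (leqP q) => hq.
    apply: (leq_trans _ (leq_pmulr _ (prime_gt0 qp))).
    by rewrite trunc_logP ?prime_gt1 ?expn_gt0.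
  rewrite mul1n -[X in _ <= X]expn1 leq_pexp2l ?prime_gt0 // -ltnS.
  rewrite -(ltn_exp2l _ _ (prime_gt1 qp)).
  apply: leq_ltn_trans (trunc_logP (prime_gt1 qp) _) _; rewrite ?expn_gt0 //.
  by rewrite mulnC expnM ltn_exp2r.
rewrite big_split leq_mul //= -big_mkcondr /= [X in _ <= X]expnM -big_filter.
rewrite big_const_seq iter_muln_1 count_predT leq_pexp2l ?expn_gt0 //.
rewrite size_filter; apply: leq_trans (count_iota_leq (2 ^ h) Z).
by rewrite /index_iota subn0; apply: sub_count => q /andP[].
Qed.

Lemma expn_quadratic (h : nat) : 18 <= h -> 32 * (4 * (h * h) + 1) <= 2 ^ h.
Proof.
elim: h => // h IHh; rewrite leq_eqVlt => /orP[/eqP <- //|h18].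
have := IHh h18; rewrite expnS; nia.
Qed.

(** In base 2 logarithms with N = 2^(2h): log m >= h |s| >= N / 8, whereas the logarithm of C
    (L+1)^K is at most 3 N / 32. *)
Lemma exists_small_exponent (K C : nat) :
  exists s L, [/\ uniq s, all prime s, all (fun p => p.-1 %| L) s, 0 < L &
    C * L.+1 ^ K <= \prod_(p <- s) p].
Proof.
(* The 6 yields 32 K 2^(2h-k+1) <= N. The factor 8 A below, shared among A values of a, keeps the
   inadmissible primes p = a q + 1 to at most N / (16 h), against at least N / (4 h) primes up to
   N. *)
set k := K + 6; set A := 2 ^ k.
have [t0 rare] := chain_count_rare rat A (8 * A).
set t := t0 + C + K + 18.
have := rare t; have : t0 <= t by rewrite /t; lia.
have : C + K + 18 <= t by rewrite /t; lia.
move: t {rare} => t tCK tt0 /(_ _ tt0); clear t0 tt0.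
have -> : 36 * t * 2 ^ t = 2 * (18 * t * 2 ^ t) by lia.
have : C + K + 18 <= 18 * t * 2 ^ t by have := expn_gt0 2 t; nia.
move: (18 * t * 2 ^ t) => h hCK rare; clear t tCK.
exists (friable_primes h k), (friable_exponent h k); split.
- by rewrite filter_uniq // iota_uniq.
- by apply/allP => p; rewrite mem_filter => /andP[/andP[]].
- by apply/allP => p; exact: friable_exponent_dvd.
- exact: friable_exponent_gt0.
have quad : 32 * (4 * (h * h) + 1) <= 2 ^ h by apply: expn_quadratic; lia.
have NX : 2 ^ (2 * h) = 2 ^ h * 2 ^ h by rewrite mul2n -addnn expnD.
have size_ge : 2 ^ (2 * h) <= 8 * (h * size (friable_primes h k)).
  have kh : k <= 2 * h by rewrite /k; lia.
  have bad : 8 * (2 * h) * \sum_(a <- iota 1 A) chain_count a (2 ^ (2 * h)) <= 2 ^ (2 * h).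
    rewrite -(leq_pmul2l (expn_gt0 2 k : 0 < A)) mulnA [A * _]mulnA [A * 8]mulnC.
    rewrite big_distrr /=.
    apply: (@leq_trans (\sum_(a <- iota 1 A) 2 ^ (2 * h))); last first.
      by rewrite big_const_seq count_predT size_iota iter_addn_0 mulnC.
    rewrite big_seq [X in _ <= X]big_seq; apply: leq_sum => a.
    by rewrite mem_iota add1n ltnS => /rare.
  have M0 : 0 < 2 * h by lia.
  have pi_ge : 2 ^ (2 * h) <= 2 * (2 * h * count prime (iota 0 (2 ^ (2 * h)).+1)).
    have := prime_count_ge (2 ^ (2 * h).-1) (expn_gt0 _ _).
    rewrite -expnS prednK // -expnM leq_exp2l // => H.
    by rewrite -{1}(prednK M0) expnS leq_mul2l H orbT.
  have pi_le := friable_primes_count h k kh.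
  have {}pi_le := leq_mul (leqnn (2 * (2 * h))) pi_le.
  have small : 16 * h * (2 ^ h).+1 <= 2 ^ (2 * h).
    by rewrite NX; move: quad; clear; nia.
  move: bad pi_ge pi_le small; rewrite -/A; clear.
  move: (\sum_(_ <- _) _) => b; move: (count _ _) => p; move: (size _) => z.
  move: (2 ^ (2 * h)) => N; move: (2 ^ h) => X.
  nia.
apply: (@leq_trans (2 ^ (h * size (friable_primes h k)))); last first.
  have : all (leq (2 ^ h)) (friable_primes h k).
    by apply/allP => p; rewrite mem_filter mem_index_iota => /and3P[_ /ltnW].
  elim: (friable_primes h k) => [|p s IHs] /=; first by rewrite muln0 big_nil.
  by case/andP=> hp sp; rewrite big_cons mulnS expnD leq_mul // IHs.
have L2 : (friable_exponent h k).+1 <=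
    2 ^ (1 + (2 * h * (2 ^ h).+1 + 2 ^ (2 * h - k).+1)).
  have := friable_exponent_le h k; have := friable_exponent_gt0 h k.
  by rewrite [2 ^ (1 + _)]expnD expn1; lia.
apply: (@leq_trans (2 ^ C * 2 ^ ((1 + (2 * h * (2 ^ h).+1 + 2 ^ (2 * h - k).+1)) * K))).
  rewrite leq_mul //; first exact/ltnW/ltn_expl.
  by rewrite expnM; case: (K) => // K1; rewrite leq_exp2r.
rewrite -expnD leq_pexp2l //.
have E2 : 32 * (K * 2 ^ (2 * h - k).+1) <= 2 ^ (2 * h).
  have -> : 2 ^ (2 * h) = 32 * (2 ^ K * 2 ^ (2 * h - k).+1).
    rewrite -expnD -[32]/(2 ^ 5) -expnD; congr (2 ^ _); rewrite /k; lia.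
  by rewrite leq_mul2l leq_mul2r (ltnW (ltn_expl _ _)) ?orbT.
have Ch : C <= h by lia.
have Kh : K <= h by lia.
have E1 : 16 * (C + K + K * (2 * h * (2 ^ h).+1)) <= 2 ^ (2 * h).
  rewrite NX.
  apply: (@leq_trans (16 * (h + h + h * (2 * h * (2 ^ h).+1)))).
    by rewrite leq_mul2l /= !leq_add // leq_mul2r Kh orbT.
  move: quad; clear; move: (2 ^ h) => X quad.
  have h1 : h <= h * h by nia.
  have h2 : h * h <= h * h * X by rewrite leq_pmulr //; lia.
  have h3 : (128 * (h * h) + 32) * X <= X * X by rewrite leq_mul2r; lia.
  lia.
move: size_ge E1 E2; clear.
move: (size _) => z; move: (2 ^ (2 * h - k).+1) => Y.
move: (2 * h * (2 ^ h).+1) => X; move: (2 ^ (2 * h)) => N.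
nia.
Qed.

(** * Counting residues *)

(** The extra factor c covers the case p | c. *)
Lemma fermat_expn (p c i : nat) : prime p -> c ^ (i * p.-1).+1 = c %[mod p].
Proof.
move=> pp; elim: i => [|i IHi]; first by rewrite mul0n expn1.
have -> : (i.+1 * p.-1).+1 = (i * p.-1 + p)%N.
  by rewrite mulSn addnC -addnS prednK // prime_gt0.
by rewrite expnD -modnMmr fermat_little // modnMmr -expnSr.
Qed.

(** Positive exponents go to 1, ..., L and only 0 goes to 0, because x^L is not 1 modulo a prime
    dividing x when L > 0. *)
Definition reduce_exponent (L n : nat) : nat := if n is n'.+1 then (n' %% L).+1 else 0.

Lemma reduce_exponent_le (L n : nat) : 0 < L -> reduce_exponent L n < L.+1.
Proof. by case: n => //= n L0; rewrite ltnS ltn_pmod. Qed.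

Local Open Scope ring_scope.

(** As p - 1 | L, Fermat gives the congruence modulo each p in s; distinct primes combine to their
    product. *)
Lemma expr_reduce_mod (s : seq nat) (L n : nat) (x : int) :
  uniq s -> all prime s -> all (fun p => p.-1 %| L)%N s ->
  (x ^+ n = x ^+ reduce_exponent L n %[mod (\prod_(p <- s) p)%N%:Z])%Z.
Proof.
move=> us sp sL; apply/eqP; rewrite eqz_mod_dvd; apply: prod_primes_dvd => //.
apply/allP => p ps; have pp := allP sp p ps; have /dvdnP[d Ld] := allP sL p ps.
suff: (p%:Z %| x ^+ n - x ^+ reduce_exponent L n)%Z by [].
rewrite -eqz_mod_dvd; case: n => // n /=.
have [c xc] : exists c : nat, (x %% p%:Z)%Z = c%:Z.
  by exists `|(x %% p%:Z)%Z|%N; rewrite gez0_abs // modz_ge0 //; have := prime_gt0 pp; lia.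
rewrite -(modzXm n.+1) -(modzXm (n %% L).+1) xc -[c%:Z]natz -!natrX.
rewrite !natz !modz_nat eqz_nat; apply/eqP.
have := fermat_expn p c (n %/ L * d) pp; rewrite -mulnA -Ld expnSr => H.
rewrite {1}(divn_eq n L) -addnS expnD expnS mulnA -modnMml H modnMml.
by rewrite -expnS.
Qed.

Lemma expsum_reduce_mod (k l : nat) (a : 'I_k -> int) (b : 'I_k -> 'I_l -> int)
  (s : seq nat) (L : nat) (alpha : 'I_k -> 'I_l -> nat) :
  uniq s -> all prime s -> all (fun p => p.-1 %| L)%N s ->
  (expsum a b alpha = expsum a b (fun i j => reduce_exponent L (alpha i j))
     %[mod (\prod_(p <- s) p)%N%:Z])%Z.
Proof.
move=> us sp sL; set m := (\prod_(p <- s) p)%N.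
rewrite /expsum; apply: (big_ind2 (fun x y : int => (x = y %[mod m%:Z])%Z)) => //.
  by move=> x1 x2 y1 y2 hx hy; rewrite -modzDm hx hy modzDm.
move=> i _; rewrite -modzMmr -[in RHS]modzMmr; congr ((_ * _) %% _)%Z.
apply: (big_ind2 (fun x y : int => (x = y %[mod m%:Z])%Z)) => //.
  by move=> x1 x2 y1 y2 hx hy; rewrite -modzMm hx hy modzMm.
by move=> j _; exact: expr_reduce_mod.
Qed.

(** Solvable residues are values of [expsum] at reduced exponents. T has one entry per choice of k l
    exponents in 0, ..., L, possibly with repetitions. *)
Lemma residues_small (k l : nat) (a : 'I_k -> int) (b : 'I_k -> 'I_l -> int)
  (s : seq nat) (L : nat) :
  uniq s -> all prime s -> all (fun p => p.-1 %| L)%N s -> (0 < L)%N ->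
  exists2 T : seq nat, size T = (L.+1 ^ (k * l))%N &
    forall c, solvable_mod a b (\prod_(p <- s) p)%N c ->
      `|(c %% (\prod_(p <- s) p)%N%:Z)%Z|%N \in T.
Proof.
move=> us sp sL L0; set m := (\prod_(p <- s) p)%N.
pose F (f : {ffun 'I_k * 'I_l -> 'I_L.+1}) :=
  `|(expsum a b (fun i j => f (i, j)) %% m%:Z)%Z|%N.
exists [seq F f | f : {ffun 'I_k * 'I_l -> 'I_L.+1}].
  by rewrite size_map -cardE card_ffun card_prod !card_ord.
move=> c [alpha /esym ->]; rewrite (expsum_reduce_mod k l a b s L) // -/m.
apply/mapP; exists [ffun ij => Ordinal (reduce_exponent_le L (alpha ij.1 ij.2) L0)].
  by rewrite mem_enum.
by rewrite /F; congr (absz (_ %% _)%Z); apply: eq_bigr => i _; congr (_ * _);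
  apply: eq_bigr => j _; rewrite ffunE.
Qed.

Lemma count_residues_le (T : seq nat) (m n N : nat) : (0 < m)%N ->
  (count (fun i : nat => `|((i%:Z - n%:Z) %% m%:Z)%Z|%N \in T) (iota 0 N)
   <= size T * (N %/ m).+1)%N.
Proof.
move=> m0; elim: T => [|r T IHT]; first by rewrite (@eq_count _ _ pred0) ?count_pred0.
have H : (count (fun i => i == r + n %[mod m]) (iota 0 N) <= (N %/ m).+1)%N.
  have mm : (m %/ m = 1)%N by rewrite divnn m0.
  rewrite count_modE // -addn1 -mm -divnDr // leq_div2r // leq_add2l.
  exact: leq_trans (leq_subr _ _) (leq_pred m).
rewrite mulSn; apply: leq_trans (leq_add H IHT).
rewrite -count_predUI; apply: leq_trans (leq_addr _ _).
apply: sub_count => i /=; rewrite inE => /orP[/eqP ir|->]; last by rewrite orbT.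
apply/orP; left; apply/eqP/eqP.
have ge0 : 0 <= ((i%:Z - n%:Z) %% m%:Z)%Z by apply: modz_ge0; move: m0; clear; lia.
rewrite -eqz_nat -!modz_nat eqz_mod_dvd PoszD -ir gez0_abs //.
rewrite opprD addrA addrAC -eqz_mod_dvd.
by rewrite modz_mod.
Qed.

(** B is to be the number of c with residue in T. From D B <= 2 (N - B) the ratio is at most B / (N
    - B) <= 2 / D < e. *)
Lemma ratio_lt (R : realFieldType) (cH c0 B N D e : R) :
  0 < e -> 0 < D -> 2 < e * D -> 0 < N -> 0 <= cH -> cH <= B -> N <= c0 + B ->
  (D + 2) * B <= 2 * N -> `|0 - cH / c0| < e.
Proof.
move=> e0 D0 eD N0 cH0 cHB cB DB.
have B0 : 0 <= B by exact: le_trans cHB.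
have NB : 0 < N - B by nra.
have c00 : 0 < c0 by lra.
have DNB : D * B <= 2 * (N - B) by lra.
have eDNB : 2 * (N - B) < e * D * (N - B) by rewrite ltr_pM2r.
have H : B < e * (N - B) by rewrite -(ltr_pM2l D0) mulrCA mulrA; lra.
rewrite sub0r normrN ger0_norm ?divr_ge0 // ?ltW // ltr_pdivrMr //.
apply: le_lt_trans cHB (lt_le_trans H _).
by rewrite ler_pM2l //; lra.
Qed.

(** * Density of H inside H_0 *)

Local Open Scope classical_set_scope.
Local Open Scope ring_scope.

Theorem theorem1 (R : realType) (k l : nat) (hk : (1 <= k)%N) (hl : (1 <= l)%N)
  (a : 'I_k -> int) (b : 'I_k -> 'I_l -> int)
  (ha : forall i, a i != 0) (hb : forall i j, b i j != 0) :
  (fun n : nat => ((count_upto (Hset a b) n)%:R / (count_upto (H0set a b) n)%:R : R))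
    @ \oo --> (0 : R).
Proof.
apply/cvgrPdist_lt => e e0.
set D := Num.bound (2 / e).
have eD : 2 / e < D%:R by apply: archi_boundP; rewrite divr_ge0 // ltW.
have D0 : 0 < D%:R :> R by apply: lt_trans eD; rewrite divr_gt0.
(* With K = k l and C = D + 2, the residues in T are at most a share 1 / (D + 2) of all residues mod
   m. *)
have [s [L [us sp sL L0 Cm]]] := exists_small_exponent (k * l) (D + 2).
have [T sT HT] := residues_small k l a b s L us sp sL L0.
move: Cm HT; rewrite -sT; set m := (\prod_(p <- s) p)%N => Cm HT.
have m2 : (2 <= m)%N.
  apply: leq_trans Cm; rewrite -[2%N]/(2 * 1)%N leq_mul //.
    by rewrite addnC leq_addr.
  by rewrite sT expn_gt0.
have m0 : (0 < m)%N by exact: ltnW.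
(* For n >= m the boundary term in m (floor(N / m) + 1) <= N + m is absorbed into 2 N. *)
exists m => // n /= mn.
pose A (i : nat) := `|((i%:Z - n%:Z) %% m%:Z)%Z|%N \in T.
set N := (2 * n + 1)%N.
have HB := count_residues_le T m n N m0; rewrite -/A in HB.
set B := count A (iota 0 N) in HB.
have DB : ((D + 2) * B <= 2 * N)%N.
  apply: leq_trans (leq_mul (leqnn _) HB) _; rewrite mulnA.
  apply: leq_trans (leq_mul Cm (leqnn _)) _.
  rewrite mulnS mulnC; have := leq_trunc_div N m.
  by rewrite mul2n -addnn addnC => h; rewrite leq_add // /N; lia.
apply: (@ratio_lt R _ _ B%:R N%:R D%:R) => //.
- by rewrite mulrC -ltr_pdivrMr.
- by rewrite ltr0n /N addn1.
- rewrite ler_nat /count_upto size_filter count_map; apply: sub_count => i /=.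
  by move=> /asboolP[_ /(_ m m2) /HT].
(* A c with residue outside T is unsolvable modulo m, hence lies in H_0. *)
- rewrite -natrD ler_nat /count_upto size_filter count_map.
  rewrite -{1}(size_iota 0 N) -(count_predC A) addnC leq_add2r.
  apply: sub_count => i /= Ai; apply/asboolP => -[alpha E].
  by move/negP: Ai; apply; apply: HT; exists alpha; rewrite E.
- by rewrite -natrD -!natrM ler_nat.
Qed.
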